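(* There exists a function $N:(0,+\infty)^2\to(0,+\infty)$, increasing in both variables, such that: for every $(k_0,T)\in(0,+\infty)^2$ and every $c\in\Lambda(k_0)$, there exists a control function $c^T\in\Lambda(k_0)$ satisfying $$U(c^T;k_0)\ge U(c;k_0),\qquad c^T=c\wedge N(k_0,T)\ \text{ almost everywhere in }[0,T].$$ In particular, $c^T$ is bounded above on $[0,T]$ (almost everywhere) by a quantity which does not depend on the original control $c$, but only on $T$ and on the initial state $k_0$.
   Context: Notation: $a\wedge b=\min\{a,b\}$; ''increasing'' is meant in the weak (nondecreasing) sense. Production function: $F:\mathbb{R}\to\mathbb{R}$ is $\mathcal{C}^1$ with $F'>0$ on $\mathbb{R}$, $F(0)=0$, $\lim_{x\to+\infty}F(x)=+\infty$, $L:=\lim_{x\to+\infty}F'(x)>0$; for some $0<\underline{k}<\overline{k}$, $F$ is concave on $[0,\underline{k}]$ and on $[\overline{k},+\infty)$ and convex on $[\underline{k},\overline{k}]$. Utility: $\rho>0$, and $u:[0,+\infty)\to\mathbb{R}$ is strictly increasing and strictly concave, continuous on $[0,+\infty)$ and $\mathcal{C}^2$ on $(0,+\infty)$, with $u(0)=0$, $\lim_{x\to+\infty}u(x)=+\infty$, $\lim_{x\to0^+}u'(x)=+\infty$, $\lim_{x\to+\infty}u'(x)=0$; $\epsilon_0>0$ is a fixed constant with $\lim_{t\to+\infty}e^{\epsilon_0 t}e^{-\rho t}u\left(e^{(L+\epsilon_0)t}\right)=0$. State equation: for $k_0\ge0$ and $c\in\mathcal{L}^1_{loc}([0,+\infty),\mathbb{R})$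 (integrable on each bounded interval $[0,T]$), $k(\cdot;k_0,c)$ is the unique (locally absolutely continuous) solution of $k(0)=k_0$, $\dot k(t)=F(k(t))-c(t)$ for (a.e.) $t\ge0$. Admissible controls: $\Lambda(k_0)$ is the set of $c\in\mathcal{L}^1_{loc}([0,+\infty),\mathbb{R})$ such that $c\ge0$ almost everywhere and $k(\cdot;k_0,c)\ge0$ (i.e. the solution is defined and nonnegative on all of $[0,+\infty)$). Functional: $U(c;k_0):=\int_0^{+\infty}e^{-\rho t}u(c(t))\,dt$ for $c\in\Lambda(k_0)$. *)

(* Defs.v *)
From HB Require Import structures.
From mathcomp Require Import all_boot all_order all_algebra.
From mathcomp Require Import all_classical all_reals all_analysis.
Import Order.TTheory GRing.Theory Num.Theory.
Import numFieldNormedType.Exports.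

Set Implicit Arguments.
Unset Strict Implicit.
Unset Printing Implicit Defensive.

Local Open Scope ring_scope.
Local Open Scope classical_set_scope.

Section Definitions.
Context {R : realType}.
Implicit Types (F u k c : R -> R).

Local Notation mu := (@lebesgue_measure R).

Definition concave_function (D : set R) (f : R -> R) : Prop :=
  convex_function D (fun x => - f x).

Definition strictly_concave (D : set R) (f : R -> R) : Prop :=
  forall x y t : R, D x -> D y -> x != y -> 0 < t < 1 ->
    t * f x + (1 - t) * f y < f (t * x + (1 - t) * y).

Record production_function F (L kl ku : R) : Prop := {
  prod_derivable : forall x : R, derivable F x 1 ;
  prod_C1 : continuous F^`() ;
  prod_derive_gt0 : forall x : R, 0 < F^`() x ;
  prod_0 : F 0 = 0 ;
  prod_cvgy : F x @[x --> +oo] --> +oo ;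
  prod_L_gt0 : 0 < L ;
  prod_derive_cvg : F^`() x @[x --> +oo] --> L ;
  prod_kl_gt0 : 0 < kl ;
  prod_kl_lt_ku : kl < ku ;
  prod_concave_low : concave_function `[0, kl] F ;
  prod_convex_mid : convex_function (`[kl, ku] : set R) F ;
  prod_concave_high : concave_function `[ku, +oo[ F }.

(* [u] is only meaningful on [0, +oo[; its values at negative arguments are
   left unconstrained. *)
Record utility_function u : Prop := {
  util_increasing : {in `[0, +oo[ &, {homo u : x y / x < y}} ;
  util_strictly_concave : strictly_concave `[0, +oo[ u ;
  util_continuous : {within `[0, +oo[, continuous u} ;
  util_derivable : forall x : R, 0 < x -> derivable u x 1 ;
  util_derivable2 : forall x : R, 0 < x -> derivable u^`() x 1 ;
  util_C2 : forall x : R, 0 < x -> {for x, continuous u^`(2)} ;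
  util_0 : u 0 = 0 ;
  util_cvgy : u x @[x --> +oo] --> +oo ;
  util_derive_cvg0 : u^`() x @[x --> 0^'+] --> +oo ;
  util_derive_cvgy : u^`() x @[x --> +oo] --> 0 }.

Definition discount_condition u (rho L eps0 : R) : Prop :=
  expR (eps0 * t) * expR (- (rho * t)) * u (expR ((L + eps0) * t))
    @[t --> +oo] --> 0.

(* Controls are Borel representatives of the classes in L^1_loc; every
   condition imposed on them is invariant under modification on a null set. *)
Definition L1loc c : Prop :=
  forall T : R, 0 <= T -> mu.-integrable `[0, T] (EFin \o c).

Definition absolutely_continuous (a b : R) (f : R -> R) : Prop :=
  forall e : R, 0 < e -> exists2 d : R, 0 < d &
    forall (n : nat) (x y : 'I_n -> R),
      (forall i, [/\ a <= x i, x i <= y i & y i <= b]) ->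
      trivIset setT (fun i => `]x i, y i[ : set R) ->
      \sum_(i < n) (y i - x i) < d ->
      \sum_(i < n) `|f (y i) - f (x i)| < e.

(* [k] is a solution on [0, +oo[; its values at negative times are irrelevant. *)
Record trajectory F (k0 : R) c k : Prop := {
  traj_init : k 0 = k0 ;
  traj_ac : forall T : R, 0 <= T -> absolutely_continuous 0 T k ;
  traj_ode : {ae mu, forall t : R, 0 < t -> is_derive t 1 k (F (k t) - c t)} }.

(* Solutions being unique, nonnegativity of the solution is expressed as the
   existence of a nonnegative one. *)
Record admissible F (k0 : R) c : Prop := {
  adm_L1loc : L1loc c ;
  adm_ge0 : {ae mu, forall t : R, 0 <= t -> 0 <= c t} ;
  adm_traj : exists2 k, trajectory F k0 c k & forall t : R, 0 <= t -> 0 <= k t }.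

(* When [c] is admissible the integrand is nonnegative outside of the null set
   where [c] is negative, so that the integral makes sense in [0, +oo] and does
   not depend on the values of [u] at negative arguments. *)
Definition utility_functional u (rho : R) c : \bar R :=
  \int[mu]_(t in `[0, +oo[) (expR (- (rho * t)) * u (c t))%:E.

End Definitions.

(* Main.v *)
(* Truncating c at N on [0, T] saves delta, the integral of (c - N)^+ over
   [0, T], and loses at most delta times the slope of u at N. The saving is
   consumed at constant rate delta on ]T, T + 1]. By Gronwall the integral of c
   over [0, T + 1] is at most B = k0 exp (C (T + 1)), where F x <= C x for
   x >= 0; so c is at most 2B on at least half of ]T, T + 1], and there, by
   concavity, the gain is at least delta exp (- rho (T + 1)) times the slope of
   u at 3B. Since the slope of u tends to 0 at infinity, N can be chosen,
   depending on B and T only, so that the gain outweighs the loss.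
   The new control is admissible because its primitive stays below that of c:
   the trajectory of c is then a subsolution of the new state equation, and
   monotone iteration produces a larger, hence nonnegative, trajectory. *)

Require Import Defs.
From mathcomp Require Import all_boot all_order all_algebra.
From mathcomp Require Import all_classical all_reals all_analysis.
From mathcomp Require Import measurable_realfun ring lra.
Import Order.TTheory GRing.Theory Num.Theory.
Import numFieldNormedType.Exports.
Local Open Scope ring_scope.
Local Open Scope classical_set_scope.

(** * Real induction and almost-everywhere reasoning *)

Lemma real_induction (R : realType) (P : R -> Prop) (T : R) : 0 <= T -> P 0 ->
  (forall x, 0 <= x <= T -> exists2 r, 0 < r & forall a b, 0 <= a -> a <= x ->
     x <= b -> b <= T -> x - r < a -> b < x + r -> P a -> P b) -> P T.
Proof.
move=> T0 P0 step.
pose S := [set x | 0 <= x <= T /\ P x].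
have S0 : S 0 by split=> //; rewrite lexx.
have hS : has_sup S by split; [exists 0|exists T => x [/andP[]]].
have sT : 0 <= sup S <= T.
  apply/andP; split; first by apply: ub_le_sup => //; exact: hS.2.
  by apply: ge_sup; [exists 0|move=> x [/andP[]]].
have /andP[s0 sT'] := sT.
have [r r0 H] := step _ sT.
have [a [/andP[a0 aT] Pa] ra] := sup_adherent r0 hS.
have as_ : a <= sup S by apply: ub_le_sup => //; [exact: hS.2|split; rewrite ?a0].
(* If [b] is [T], then [P b] is the goal; otherwise [b] exceeds [sup S], which [bs] contradicts. *)
pose b := Num.min T (sup S + r / 2).
have bT : b <= T by rewrite ge_min lexx.
have sb : sup S <= b by rewrite le_min sT' lerDl divr_ge0 ?ltW.
have Pb : P b.
  apply: (H a b) => //; rewrite gt_min ltrD2l; apply/orP; right; lra.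
have bs : b <= sup S.
  by apply: ub_le_sup; [exact: hS.2|split=> //; rewrite (le_trans s0 sb)].
move: bs Pb; rewrite /b; case: (leP T) => // _; lra.
Qed.

Lemma is_derive0_le (R : realType) (h : R -> R) (x e : R) :
  is_derive x 1 h 0 -> 0 < e ->
  exists2 r, 0 < r & forall y, `|y - x| < r -> `|h y - h x| <= e * `|y - x|.
Proof.
move=> dh e0.
have hc : z^-1 *: (h (z *: 1 + x) - h x) @[z --> 0^'] --> (0 : R).
  have := @ex_derive _ _ _ _ _ _ _ dh; rewrite /derivable => /cvg_ex[l hl].
  have l0 : l = 0 by rewrite -(@derive_val _ _ _ _ _ _ _ dh) /derive; apply/esym/cvg_lim.
  by move: hl; rewrite l0; exact.
move/cvgrPdist_le : hc => /(_ _ e0) [r /= r0 hr].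
exists r => // y yx; have [->|yx0] := eqVneq y x; first by rewrite !subrr !normr0 mulr0.
have := hr (y - x); rewrite /= sub0r normrN yx subr_eq0 => /(_ isT yx0).
rewrite sub0r normrN /GRing.scale/= mulr1 subrK normrM normfV.
by rewrite ler_pdivrMl ?normr_gt0 ?subr_eq0// mulrC.
Qed.

Lemma ae_imply2 (R : realType) (P Q S : R -> Prop) :
  (forall t, P t -> Q t -> S t) ->
  {ae @lebesgue_measure R, forall t, P t} ->
  {ae @lebesgue_measure R, forall t, Q t} ->
  {ae @lebesgue_measure R, forall t, S t}.
Proof.
move=> H [A [mA A0 AP]] [B [mB B0 BQ]].
exists (A `|` B); split; [exact: measurableU|by rewrite measureU0|].
move=> t /= nSt; have [Pt|nPt] := pselect (P t); last by left; exact: AP.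
by right; apply: BQ => Qt; exact/nSt/H.
Qed.

Lemma ae_imply (R : realType) (P S : R -> Prop) :
  (forall t, P t -> S t) ->
  {ae @lebesgue_measure R, forall t, P t} ->
  {ae @lebesgue_measure R, forall t, S t}.
Proof. by move=> H hP; apply: ae_imply2 (hP) (hP) => t Pt _; exact: H. Qed.

Lemma derivable_is_derive (R : realType) (f : R -> R) (x : R) :
  derivable f x 1 -> is_derive x 1 f (derive1 f x).
Proof. by move=> df; apply: DeriveDef => //; rewrite derive1E. Qed.

(** * Absolutely continuous functions with zero derivative almost everywhere *)

Section VanishingDerivative.
Context {R : realType}.
Local Notation mu := (@lebesgue_measure R).

(* The intervals of a chain are non-overlapping and listed from right to left:
   those of the tail lie to the left of the head. *)
Fixpoint chain (U : set R) (x : R) (s : seq (R * R)) : Prop :=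
  if s is (p, q) :: s' then
    [/\ p <= q, q <= x, `[p, q] `<=` U & chain U p s']
  else 0 <= x.

Lemma chain_le U x y s : x <= y -> chain U x s -> chain U y s.
Proof.
move=> xy; case: s => [|[p q] s] /=; first by move=> /le_trans; apply.
by move=> [pq qx U' c]; split=> //; exact: le_trans xy.
Qed.

Lemma chain_ge0 U x s : chain U x s -> 0 <= x.
Proof.
elim: s x => [//|[p q] s IH] x /= [pq qx _ /IH p0].
by rewrite (le_trans p0)// (le_trans pq).
Qed.

Lemma chain_nth U x s i : chain U x s -> (i < size s)%N ->
  let I := nth (0, 0) s i in [/\ 0 <= I.1, I.1 <= I.2 & I.2 <= x].
Proof.
elim: s x i => [//|[p q] s IH] x [|i] /= [pq qx _ c] => [_|].
  by split=> //; exact: chain_ge0 c.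
rewrite ltnS => /(IH p _ c)[I0 I12 I2]; split=> //.
by rewrite (le_trans I2)// (le_trans pq).
Qed.

Lemma chain_nth_lt U x s i j : chain U x s -> (i < j < size s)%N ->
  (nth (0, 0) s j).2 <= (nth (0, 0) s i).1.
Proof.
elim: s x i j => [x i j _|[p q] s IH x i [|j]] /=; rewrite ?ltn0 ?andbF//.
move=> [pq qx _ c]; case: i => [|i] /=; rewrite !ltnS.
  by move=> js; have [] := chain_nth _ _ _ _ c js.
exact: IH c.
Qed.

(** The tail is measured inside [[0, p[] and the head is [[p, q[]; half-open intervals stay disjoint
    even when consecutive intervals share an end point. *)
Lemma chain_measure (U : set R) (x : R) s : measurable U -> chain U x s ->
  ((\sum_(I <- s) (I.2 - I.1))%:E <= mu (U `&` `[0%R, x[))%E.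
Proof.
move=> mU; elim: s x => [x _|[p q] s IH x] /=; first by rewrite big_nil.
move=> [pq qx pqU c]; have p0 := chain_ge0 _ _ _ c.
rewrite big_cons EFinD addeC /=.
have -> : (q - p)%:E = mu `[p, q[.
  rewrite lebesgue_measure_itv/= lte_fin.
  by move: pq; rewrite le_eqVlt => /predU1P[->|->]; rewrite ?ltxx ?subrr.
apply: (@le_trans _ _ (mu (U `&` `[0%R, p[) + mu `[p, q[%classic)%E).
  by rewrite leeD2r// IH.
rewrite -measureU//.
- rewrite le_measure ?inE//.
  + by apply: measurableU => //; exact: measurableI.
  + exact: measurableI.
  + move=> z [[Uz]|] /=; rewrite !in_itv/= => /andP[z0 zp].
      by split=> //; rewrite z0 (lt_le_trans zp)// (le_trans pq).
    split; first by apply: pqU; rewrite /= in_itv/= z0 ltW.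
    by rewrite (le_trans p0)//= (lt_le_trans zp).
- exact: measurableI.
- apply/seteqP; split=> // z [[_ ]] /=; rewrite !in_itv/= => /andP[_ zp] /andP[pz _].
  by move: zp; rewrite ltNge pz.
Qed.

(** Recasts a chain as the indexed family that absolute continuity expects: the ordering gives
    disjointness and [chain_measure] bounds the total length. *)
Lemma chain_ac_lt (U : set R) (h : R -> R) (T e d : R) s : measurable U -> (mu U < d%:E)%E ->
  (forall (n : nat) (x y : 'I_n -> R),
      (forall i, [/\ 0 <= x i, x i <= y i & y i <= T]) ->
      trivIset setT (fun i => `]x i, y i[ : set R) ->
      \sum_(i < n) (y i - x i) < d ->
      \sum_(i < n) `|h (y i) - h (x i)| < e) ->
  chain U T s -> \sum_(I <- s) `|h I.2 - h I.1| < e.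
Proof.
move=> mU Ud hac c.
have := hac (size s) (fun i => (nth (0, 0) s i).1) (fun i => (nth (0, 0) s i).2).
have E (f : R * R -> R) :
    \sum_(I <- s) f I = \sum_(i < size s) f (nth (0, 0) s i).
  by rewrite (big_nth (0, 0)) big_mkord.
rewrite -(E (fun I => I.2 - I.1)) -(E (fun I => `|h I.2 - h I.1|)); apply.
- by move=> i; exact: (chain_nth U).
- suff lt_disj i j : (i < j < size s)%N ->
      `](nth (0, 0) s i).1, (nth (0, 0) s i).2[ `&`
      `](nth (0, 0) s j).1, (nth (0, 0) s j).2[ = set0 :> set R.
    apply/trivIsetP => i j _ _ ij.
    have [ltij|ltji|/val_inj eqij] := ltngtP i j.
    + by apply: lt_disj; rewrite ltij ltn_ord.
    + by rewrite setIC; apply: lt_disj; rewrite ltji ltn_ord.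
    + by rewrite eqij eqxx in ij.
  move=> ij; have ji := chain_nth_lt _ _ _ _ _ c ij.
  apply/seteqP; split=> // z [] /=; rewrite !in_itv/= => /andP[iz _] /andP[_ zj].
  by have := lt_trans (lt_le_trans zj ji) iz; rewrite ltxx.
- rewrite -lte_fin; apply: le_lt_trans (chain_measure _ _ _ mU c) _.
  by apply: le_lt_trans Ud; rewrite le_measure ?inE//; exact: measurableI.
Qed.

(** Outer regularity controls only the measure of [U] minus [Z], which is that of [U] because [Z] is
    null. *)
Lemma open_cover_null (Z : set R) (d : R) : measurable Z -> mu Z = 0%E ->
  0 < d -> exists U : set R, [/\ open U, Z `<=` U & (mu U < d%:E)%E].
Proof.
move=> mZ Z0 d0.
have [|U [oU ZU Ud]] := lebesgue_regularity_outer mZ _ d0; first by rewrite [X in (X < _)%E]Z0.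
exists U; split=> //; apply: le_lt_trans Ud.
rewrite -[X in mu X](setDUK ZU) measureU//.
- by rewrite [X in (X + _)%E]Z0 add0e.
- by apply: measurableD => //; exact: open_measurable.
- by apply/seteqP; split=> // z [? []].
Qed.

(* Real induction on x: up to x, the variation of h is at most e * x plus the
   variation of h over a chain of intervals covered by a small open set U that
   contains the exceptional points; absolute continuity bounds the latter. *)
Lemma ac_derive0_const (h : R -> R) (T : R) : 0 <= T -> absolutely_continuous 0 T h ->
  {ae mu, forall t, 0 < t < T -> is_derive t 1 h 0} -> h T = h 0.
Proof.
move=> T0 hac [Z0 [mZ0 Z00 Z0P]].
apply/eqP; rewrite -subr_eq0 -normr_eq0; apply/eqP/le_anti; rewrite normr_ge0 andbT.
apply/ler_addgt0Pr => e' e'0; rewrite add0r.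
(* With this choice the two error terms [e * T] and [e] add up to [e']. *)
pose e := e' / (T + 1).
have T10 : 0 < T + 1 by lra.
have e0 : 0 < e by rewrite divr_gt0.
have [d d0 hd] := hac _ e0.
(* The end points count as exceptional, since the derivative is known only inside []0, T[]. *)
pose Z := Z0 `|` [set 0] `|` [set T].
have mZ : measurable Z by apply: measurableU => //; exact: measurableU.
have [|U [oU ZU Ud]] := open_cover_null Z d mZ _ d0.
  have mZ0' : measurable (Z0 `|` [set 0]) by exact: measurableU.
  by rewrite /Z measureU0// ?measureU0//; exact: lebesgue_measure_set1.
have mU : measurable U by exact: open_measurable.
suff [s cs hs] : exists2 s, chain U T s &
    `|h T - h 0| <= e * T + \sum_(I <- s) `|h I.2 - h I.1|.
  apply: (le_trans hs).
  have /ltW hsum := chain_ac_lt _ _ _ _ _ _ mU Ud hd cs.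
  apply: le_trans (lerD (lexx _) hsum) _.
  by rewrite -[X in _ + X]mulr1 -mulrDr /e divfK ?gt_eqF.
pose P x := exists2 s, chain U x s &
    `|h x - h 0| <= e * x + \sum_(I <- s) `|h I.2 - h I.1|.
apply: (real_induction _ P _ T0).
  by exists [::] => //=; rewrite subrr normr0 mulr0 big_nil addr0.
move=> x /andP[x0 xT].
have [Zx|Zx] := pselect (Z x).
  (* A ball around an exceptional point lies in [U], so [[a, b]] can be put at the head of the
     chain. *)
  have [r /= r0 xrU] : nbhs x U by apply: open_nbhs_nbhs; split=> //; exact: ZU.
  exists r => // a b a0 ax xb bT xra bxr [s cs hs].
  exists ((a, b) :: s) => /=.
    split=> //; first exact: le_trans xb.
    move=> z /=; rewrite in_itv/= => /andP[az zb].
    by apply: xrU; rewrite /= ltr_norml; apply/andP; split; lra.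
  rewrite big_cons /= -(subrKA (h a)).
  apply: le_trans (ler_normD _ _) _.
  have : e * a <= e * b by rewrite ler_pM2l// (le_trans ax).
  move: hs; set S := \sum_(I <- s) _; set A := `|_|; set B := `|_|.
  by move: (e * a) (e * b) => ea eb; lra.
have dx : is_derive x 1 h 0.
  apply: contrapT => ndx; apply: Zx.
  have [->|x_neq0] := eqVneq x 0; first by left; right.
  have [->|x_neqT] := eqVneq x T; first by right.
  left; left; apply: Z0P => /= H; apply/ndx/H.
  by rewrite !lt_neqAle x0 xT x_neqT eq_sym x_neq0.
(* At a regular point the chain is kept: [h] varies by at most [e * (x - a)] and [e * (b - x)] on
   the two sides of [x]. *)
have [r r0 hr] := is_derive0_le _ _ _ _ dx e0.
exists r => // a b a0 ax xb bT xra bxr [s cs hs].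
exists s; first by apply: chain_le cs; exact: le_trans xb.
have hb : `|h b - h x| <= e * (b - x).
  by rewrite -(@ger0_norm _ (b - x)) ?subr_ge0// hr// ger0_norm ?subr_ge0//; lra.
have ha : `|h x - h a| <= e * (x - a).
  rewrite distrC -(@ger0_norm _ (x - a)) ?subr_ge0// [X in _ * X]distrC hr//.
  by rewrite distrC ger0_norm ?subr_ge0//; lra.
have -> : h b - h 0 = (h b - h x) + (h x - h a) + (h a - h 0) by lra.
apply: le_trans (ler_normD _ _) _.
apply: le_trans (lerD (ler_normD _ _) (lexx _)) _.
move: hs hb ha; rewrite !mulrBr; set S := \sum_(I <- s) _.
by move: (e * a) (e * b) (e * x) => ea eb ex; lra.
Qed.

End VanishingDerivative.

(** * Primitives of locally integrable functions *)

Section IndefiniteIntegral.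
Context {R : realType}.
Implicit Types (f g h : R -> R) (T t : R).
Local Notation mu := (@lebesgue_measure R).
Local Notation I g t := (\int[mu]_(s in `[0, t]) g s).

(** For negative [T] the interval is empty, so no sign condition on [T] is needed. *)
Lemma L1loc_integrable g T : L1loc g -> mu.-integrable `[0, T] (EFin \o g).
Proof.
move=> gl; have [T0|T0] := leP 0 T; first exact: gl.
rewrite set_itv_ge ?bnd_simp -?ltNge//; apply: integrableS (gl 0 (lexx _)) => //.
Qed.

Lemma L1loc_restrict g T : L1loc g ->
  mu.-integrable setT (EFin \o (g \_ `[0, T])).
Proof.
move=> gl; rewrite -restrict_EFin; apply/integrable_restrict => //=.
by rewrite setTI; exact: L1loc_integrable.
Qed.

Lemma primitiveB g s t : L1loc g -> 0 <= s -> s <= t ->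
  I g t - I g s = \int[mu]_(x in `]s, t]) g x.
Proof.
by move=> gl s0 st; apply: Rintegral_itvB; rewrite ?bnd_simp//; exact: L1loc_integrable.
Qed.

(** The bound uses an open interval and the restriction of [g] to [[0, T]] so that it can be summed
    over the disjoint open intervals of [absolutely_continuous]. *)
Lemma normr_primitiveB_le g T s t : L1loc g -> 0 <= s -> s <= t -> t <= T ->
  ((`|I g t - I g s|)%:E <=
    \int[mu]_(x in `]s, t[) (`|(g \_ `[0%R, T]) x|)%:E)%E.
Proof.
move=> gl s0 st tT.
have stT : `]s, t] `<=` `[0, T].
  by apply: subset_itv; rewrite bnd_simp.
have gi : mu.-integrable `]s, t] (EFin \o g).
  by apply: integrableS (L1loc_integrable g T gl).
rewrite primitiveB// (@integral_itv_bndo_bndc _ (BRight s)); last first.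
  apply/measurable_EFinP; apply: measurableT_comp => //.
  have /integrableP[/measurable_EFinP + _] := L1loc_restrict g T gl.
  exact: measurable_funS.
under eq_integral => x.
  rewrite inE => /stT xT; rewrite patchE mem_set//.
  over.
rewrite -[X in (_ <= X)%E]fineK.
  by rewrite lee_fin; exact: le_normr_Rintegral.
by apply: integrable_fin_num => //; exact: integrable_norm.
Qed.

(** The integral of [|g|] over a set of small measure is small; here the set is the union of the
    given intervals. *)
Lemma primitive_ac g T : L1loc g -> absolutely_continuous 0 T (fun t => I g t).
Proof.
move=> gl e e0; have gTi := L1loc_restrict g T gl.
have [d [d0 hd]] := integral_normr_continuous gTi e0.
exists d => // n x y xy tI sd.
pose D := \big[setU/set0]_(i < n) (`]x i, y i[ : set R).
have mD : measurable D by exact: bigsetU_measurable.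
have muD : mu D = (\sum_(i < n) (y i - x i))%:E.
  rewrite /D measure_bigsetU_ord// -sumEFin; apply: eq_bigr => i _.
  apply: etrans (lebesgue_measure_itv _) _; rewrite /= lte_fin; have [_ + _] := xy i.
  by rewrite le_eqVlt => /predU1P[->|->]; rewrite ?ltxx ?subrr.
have := hd D mD; rewrite [X in (X < _)%E]muD lte_fin => /(_ sd); apply: le_lt_trans.
have gDi : mu.-integrable D (EFin \o (Num.norm \o (g \_ `[0, T]))).
  by apply: (@integrableS _ _ _ _ setT) => //; exact: integrable_norm.
rewrite -lee_fin fineK; last exact: integrable_fin_num gDi.
rewrite ge0_integral_bigsetU//.
- rewrite -sumEFin; apply: lee_sum => i _; have [? ? ?] := xy i.
  exact: normr_primitiveB_le.
- exact: index_enum_uniq.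
- by apply: sub_trivIset tI.
- by case/integrableP : gDi.
Qed.

(** Extending [g] by zero gives a function on the whole line, to which the differentiation theorem
    applies. *)
Lemma L1loc_locally_integrable g : L1loc g ->
  locally_integrable setT (g \_ `[0, +oo[).
Proof.
move=> gl; split; last 1 first.
- move=> K _ cK; have /compact_bounded[M [_ hM]] := cK.
  pose T := M + 1.
  have KT : forall x, K x -> x <= T.
    by move=> x Kx; apply: le_trans (ler_norm _) (hM T _ x Kx); rewrite /T ltrDl.
  apply: (@le_lt_trans _ _ (\int[mu]_(x in K) (`|(g \_ `[0%R, T]) x|)%:E)%E).
    rewrite le_eqVlt; apply/orP; left; apply/eqP; apply: eq_integral => x.
    rewrite inE => /KT xT; rewrite !patchE.
    have -> : (x \in (`[0, +oo[ : set R)) = (x \in (`[0, T] : set R)) => //.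
    by apply/idP/idP; rewrite !inE/= !in_itv/= xT andbT// => ->.
  have /integrableP[mg] := L1loc_restrict g T gl.
  apply: le_lt_trans; apply: ge0_subset_integral => //.
  - exact: compact_measurable.
  - by apply/measurable_EFinP/measurableT_comp => //; exact/measurable_EFinP.
(* At each point the restrictions to [[0, n]] are eventually constant in [n], so their limit is
   measurable. *)
- apply: (@measurable_fun_cvg _ _ _ _ (fun n => g \_ `[0, n%:R])).
  + move=> n; have /integrableP[/measurable_EFinP //] := L1loc_restrict g n%:R gl.
  + move=> x _.
    apply: cvg_near_cst; near=> n; rewrite !patchE.
    have -> : (x \in (`[0, +oo[ : set R)) = (x \in (`[0, n%:R] : set R)) => //.
    apply/idP/idP; rewrite !inE/= !in_itv/= ?andbT; last by case/andP.
    move=> ->/=; near: n; exact: nbhs_infty_ger.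
- exact: openT.
Unshelve. all: by end_near. Qed.

(** Lebesgue differentiation for the extension of [g] by zero, which has the same primitive. *)
Lemma primitive_is_derive g : L1loc g ->
  {ae mu, forall t, 0 < t -> is_derive t 1 (fun t => I g t) (g t)}.
Proof.
move=> gl.
have E t : I (g \_ `[0, +oo[) t = I g t.
  apply: eq_Rintegral => s; rewrite inE/= in_itv/= => /andP[s0 _].
  by rewrite patchE mem_set//= in_itv/= s0.
have := @FTC1 R (g \_ `[0, +oo[) (BLeft 0) _ (L1loc_locally_integrable g gl).
have intg y : mu.-integrable [set` Interval (BLeft 0) (BRight y)] (EFin \o (g \_ `[0, +oo[)).
  apply: eq_integrable (L1loc_integrable g y gl) => // s.
  rewrite inE/= in_itv/= => /andP[s0 _].
  by rewrite patchE mem_set//= in_itv/= s0.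
move=> /(_ intg); apply: ae_imply => t H t0.
have [] := H; first by rewrite /= lte_fin.
have <- : (fun t => I (g \_ `[0, +oo[) t) = (fun t => I g t) by apply/funext => x; rewrite E.
move=> dI Ig; apply: DeriveDef => //; rewrite -derive1E Ig patchE mem_set//=.
by rewrite in_itv/= ltW.
Qed.

Lemma primitive_le g h t : L1loc g -> L1loc h ->
  (forall s, 0 <= s -> g s <= h s) -> I g t <= I h t.
Proof.
move=> gl hl gh; apply: le_Rintegral => //; [exact: L1loc_integrable..|].
by move=> s /=; rewrite in_itv/= => /andP[s0 _]; exact: gh.
Qed.

End IndefiniteIntegral.

(** * The state equation in integral form *)

Section IntegralEquation.
Context {R : realType}.
Implicit Types (F c k f g : R -> R) (T t : R).
Local Notation mu := (@lebesgue_measure R).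
Local Notation I g t := (\int[mu]_(s in `[0, t]) g s).

Lemma acB f g T : absolutely_continuous 0 T f -> absolutely_continuous 0 T g ->
  absolutely_continuous 0 T (f \- g).
Proof.
move=> hf hg e e0; have e20 : 0 < e / 2 by rewrite divr_gt0.
have [d1 d10 h1] := hf _ e20; have [d2 d20 h2] := hg _ e20.
exists (Num.min d1 d2); first by rewrite lt_min d10.
move=> n x y xy tI; rewrite lt_min => /andP[/(h1 _ _ _ xy tI) s1 /(h2 _ _ _ xy tI) s2].
rewrite (splitr e); apply: le_lt_trans (ltrD s1 s2).
rewrite -big_split/=; apply: ler_sum => i _.
have -> : (f \- g) (y i) - (f \- g) (x i) = (f (y i) - f (x i)) - (g (y i) - g (x i)).
  by rewrite /=; lra.
exact: ler_normB.
Qed.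

Lemma ac_continuous f T : absolutely_continuous 0 T f ->
  {within `[0, T], continuous f}.
Proof.
move=> hf; apply/subspace_continuousP => x /= xT.
have dist e : 0 < e -> exists2 d, 0 < d &
    forall a b, 0 <= a -> a <= b -> b <= T -> b - a < d -> `|f b - f a| < e.
  move=> e0; have [d d0 hd] := hf _ e0; exists d => // a b a0 ab bT bad.
  have := hd 1%N (fun=> a) (fun=> b); rewrite !big_ord1; apply=> //.
  by apply/trivIsetP => i j; rewrite !ord1 eqxx.
apply/cvgrPdist_lt => e /dist[d d0 hd].
rewrite near_withinE; exists d => // y /= xyd; move: xT; rewrite !in_itv/=.
move=> /andP[x0 xT] /andP[y0 yT]; have [xy|yx] := leP x y.
  by rewrite distrC hd//; rewrite distrC ger0_norm ?subr_ge0 in xyd.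
by rewrite hd//; [exact: ltW|rewrite ger0_norm ?subr_ge0 ?ltW in xyd].
Qed.

Lemma L1locB f g : L1loc f -> L1loc g -> L1loc (f \- g).
Proof.
move=> hf hg T T0; rewrite (_ : _ \o _ = ((EFin \o f) \- (EFin \o g))%E)//.
by apply: integrableB => //; [exact: hf|exact: hg].
Qed.

Lemma continuous_L1loc f :
  (forall T, 0 <= T -> {within `[0, T], continuous f}) -> L1loc f.
Proof.
move=> cf T T0; apply: continuous_compact_integrable; last exact: cf.
exact: segment_compact.
Qed.

Lemma trajectory_continuous F (k0 : R) c k T : continuous F ->
  trajectory F k0 c k -> 0 <= T -> {within `[0, T], continuous (F \o k)}.
Proof.
move=> cF tk T0; have ck := ac_continuous _ _ (traj_ac tk T0).
by move=> x; apply: (@continuous_comp (subspace `[0, T]) _ _ k F x); [exact: ck|exact: cF].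
Qed.

(** The difference between [k] and the primitive of [F (k t) - c t] is absolutely continuous with
    zero derivative almost everywhere, hence constant. *)
Lemma trajectory_integral F (k0 : R) c k t : continuous F -> L1loc c ->
  trajectory F k0 c k -> 0 <= t ->
  k t = k0 + I (F \o k) t - I c t.
Proof.
move=> cF cl tk t0.
have Fl : L1loc (F \o k).
  by apply: continuous_L1loc => T; exact: trajectory_continuous tk.
have gl := L1locB _ _ Fl cl; set g := _ \- _ in gl.
have : (k \- (fun t => I g t)) t = (k \- (fun t => I g t)) 0.
  apply: ac_derive0_const => //.
    by apply: acB; [exact: (traj_ac tk)|exact: primitive_ac].
  apply: ae_imply2 (traj_ode tk) (primitive_is_derive g gl) => s dk dg /andP[s0 _].
  exact: is_derive_eq (is_deriveB (dk s0) (dg s0)) (subrr _).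
rewrite /= set_itv1 Rintegral_set1 subr0 (traj_init tk) -addrA -RintegralB//.
- by move/eqP; rewrite subr_eq => /eqP.
- exact: Fl.
- exact: cl.
Qed.

(** The equation is assumed at negative [t] too, where both integrals vanish, so that [k] is a
    constant plus a primitive as a function on the whole line. *)
Lemma integral_trajectory F (k0 : R) c k : L1loc (F \o k) -> L1loc c ->
  (forall t, k t = k0 + I (F \o k) t - I c t) -> trajectory F k0 c k.
Proof.
move=> Fl cl kE; have gl := L1locB _ _ Fl cl; set g := _ \- _ in gl.
have {}kE t : k t = k0 + I g t.
  rewrite kE -addrA -RintegralB//; exact: L1loc_integrable.
have kB a b : k b - k a = I g b - I g a by rewrite !kE opprD addrACA subrr add0r.
split.
- by rewrite kE set_itv1 Rintegral_set1 addr0.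
- move=> T T0 e e0; have [d d0 hd] := primitive_ac g T gl e e0.
  exists d => // n x y xy tI sd; have := hd n x y xy tI sd.
  by under eq_bigr => i _ do rewrite -kB.
- apply: ae_imply (primitive_is_derive g gl) => t dg t0.
  have -> : F (k t) - c t = 0 + g t by rewrite add0r.
  have -> : k = cst k0 + (fun t => I g t) by apply/funext => s; rewrite kE.
  apply: is_deriveD; exact: dg.
Qed.

End IntegralEquation.

(** * Exponential growth bound of Gronwall type *)

Section Comparison.
Context {R : realType}.
Implicit Types (F c k f g : R -> R) (C T t : R).
Local Notation mu := (@lebesgue_measure R).
Local Notation I g t := (\int[mu]_(s in `[0, t]) g s).

Lemma is_derive_expRM (a x : R) :
  is_derive x 1 (fun s => expR (a * s)) (a * expR (a * x)).
Proof.
have dM : is_derive x 1 (fun s => a * s) a.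
  by apply: is_derive_eq; rewrite /GRing.scale/= mulr1.
by apply: is_derive_eq (is_derive1_comp _ dM) _; rewrite mulrC.
Qed.

Lemma continuous_expRM (a : R) : continuous (fun s : R => expR (a * s)).
Proof.
move=> x; apply: differentiable_continuous; apply/derivable1_diffP.
by have := is_derive_expRM a x; case.
Qed.

Lemma L1loc_expRM (a b : R) : L1loc (fun s => b * expR (a * s)).
Proof.
apply: continuous_L1loc => T T0; apply: continuous_subspaceT => x.
apply: cvgM; [exact: cvg_cst|exact: continuous_expRM].
Qed.

Lemma primitive_expRM (C b t : R) : 0 < C -> 0 <= t ->
  I (fun s => C * b * expR (C * s)) t = b * expR (C * t) - b.
Proof.
move=> C0; rewrite le_eqVlt => /predU1P[<-|t0].
  by rewrite set_itv1 Rintegral_set1 mulr0 expR0 mulr1 subrr.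
have dE (x : R) : is_derive x 1 (fun s : R => b * expR (C * s)) (C * b * expR (C * x)).
  have dC := is_derive_expRM C x; apply: is_derive_eq.
  by rewrite /GRing.scale/= mulrCA mulrA.
have cE (a : R) : continuous (fun s : R => a * expR (C * s)).
  by move=> x; apply: cvgM; [exact: cvg_cst|exact: continuous_expRM].
rewrite /Rintegral (@continuous_FTC2 _ _ (fun s => b * expR (C * s)) 0 t t0)/=.
- by rewrite mulr0 expR0 mulr1.
- exact: continuous_subspaceT.
- split.
  + by move=> x _; case: (dE x).
  + by apply: cvg_at_right_filter; exact: cE.
  + by apply: cvg_at_left_filter; exact: cE.
- by move=> x _; rewrite derive1E; exact: derive_val.
Qed.

Lemma primitive_continuous g T : L1loc g -> {within `[0, T], continuous (fun t => I g t)}.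
Proof. by move=> gl; apply/ac_continuous/primitive_ac. Qed.

(** Put [w = k + I c]. Then [w' = F k <= C k <= C w], so that [w] times [exp (- C t)] does not
    increase. *)
Lemma trajectory_growth F C (k0 : R) c k t : continuous F -> 0 < C ->
  (forall x : R, 0 <= x -> F x <= C * x) -> L1loc c ->
  (forall t, 0 <= t -> 0 <= I c t) -> trajectory F k0 c k ->
  (forall t, 0 <= t -> 0 <= k t) -> 0 <= t ->
  k t + I c t <= k0 * expR (C * t).
Proof.
move=> cF C0 FC cl c0 tk k_ge0 t0.
pose w s := k0 + I (F \o k) s.
have kE (s : R) : 0 <= s -> k s + I c s = w s.
  by move=> s0; rewrite (trajectory_integral _ _ _ _ _ cF cl tk s0) subrK.
rewrite kE//; move: t0; rewrite le_eqVlt => /predU1P[<-|t0].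
  by rewrite /w set_itv1 Rintegral_set1 mulr0 expR0 mulr1 addr0.
have Fl : L1loc (F \o k).
  by apply: continuous_L1loc => T; exact: trajectory_continuous tk.
(* Since [F \o k] is continuous, [w] is differentiable at every positive time, whereas [k] is known
   to be so only almost everywhere; this permits the mean value theorem. *)
have dw (s : R) : 0 < s -> is_derive s 1 w (F (k s)).
  move=> s0; have ss1 : s < s + 1 by rewrite ltrDl.
  have [||dI IE] := @continuous_FTC1_closed R (F \o k) 0 s (s + 1) ss1 _ s0.
  - by apply: Fl; rewrite addr_ge0 ?ltW.
  - apply: (@within_continuous_continuous _ _ _ 0 (s + 1)).
    + by rewrite addr_gt0.
    + by apply: trajectory_continuous tk _ => //; rewrite addr_ge0 ?ltW.
    + by rewrite in_itv/= s0.
  have dI' : is_derive s 1 (fun s => I (F \o k) s) (F (k s)).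
    by apply: DeriveDef => //; rewrite -derive1E.
  rewrite -[F (k s)]add0r; exact: is_deriveD.
pose phi s := w s * expR (- C * s).
have dphi (s : R) : s \in `]0, t[%R ->
    is_derive s 1 phi (expR (- C * s) * (F (k s) - C * w s)).
  rewrite in_itv/= => /andP[s0 _].
  have dw' := dw s s0; have de := is_derive_expRM (- C) s.
  apply: is_derive_eq (is_deriveM dw' de) _.
  by rewrite /GRing.scale/=; ring.
have cphi : {within `[0, t], continuous phi}.
  move=> x; apply: cvgM.
    by apply: cvgD; [exact: cvg_cst|exact: primitive_continuous].
  by apply: continuous_subspaceT => {}x; exact: continuous_expRM.
have [s + phiE] := MVT t0 dphi cphi; rewrite in_itv/= => /andP[s0 st].
have : phi t <= phi 0.
  rewrite -subr_le0 phiE subr0 -mulrA mulr_ge0_le0 ?expR_ge0//.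
  rewrite mulr_le0_ge0 ?(ltW t0)// subr_le0.
  apply: (le_trans (FC _ (k_ge0 _ (ltW s0)))); rewrite ler_pM2l//.
  by rewrite -(kE _ (ltW s0)) lerDl c0 ?(ltW s0).
rewrite /phi mulr0 expR0 mulr1 {2}/w set_itv1 Rintegral_set1 addr0.
rewrite mulNr expRN ler_pdivrMr ?expR_gt0//.
Qed.

End Comparison.

(** * Construction of a trajectory above a subsolution *)

Section MonotoneIteration.
Context {R : realType} (F c c1 k : R -> R) (C k0 : R).
Local Notation mu := (@lebesgue_measure R).
Local Notation I g t := (\int[mu]_(s in `[0, t]) g s).

Hypothesis cF : continuous F.
Hypothesis ndF : {homo F : x y / x <= y}.
Hypothesis C_gt0 : 0 < C.
Hypothesis F_ge0 : forall x : R, 0 <= x -> 0 <= F x.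
Hypothesis FC : forall x : R, 0 <= x -> F x <= C * x.
Hypothesis cl : L1loc c.
Hypothesis c1l : L1loc c1.
Hypothesis c1_ge0 : forall t : R, 0 <= t -> 0 <= I c1 t.
Hypothesis c1_le : forall t : R, 0 <= t -> I c1 t <= I c t.
Hypothesis tk : trajectory F k0 c k.
Hypothesis k_ge0 : forall t : R, 0 <= t -> 0 <= k t.

(* Since [I c1 <= I c], the trajectory [k] of [c] is a subsolution for [c1], so
   that the Picard iterates started at [k] increase; they stay below [M]. *)
Let picard (h : R -> R) (t : R) : R := k0 + I (F \o h) t - I c1 t.
Let K n : R -> R := iter n picard k.
Let M (t : R) := k0 * expR (C * t).

Let k_le_M (t : R) : 0 <= t -> k t <= M t.
Proof.
move=> t0; apply: le_trans (trajectory_growth _ _ _ _ _ _ cF C_gt0 FC cl _ tk k_ge0 t0).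
  by rewrite lerDl (le_trans (c1_ge0 _ t0))// c1_le.
by move=> s s0; rewrite (le_trans (c1_ge0 _ s0))// c1_le.
Qed.

Let K_continuous n (T : R) : 0 <= T -> {within `[0, T], continuous (K n)}.
Proof.
elim: n T => [|n IH] T T0; first exact: ac_continuous _ _ (traj_ac tk T0).
have Fl : L1loc (F \o K n).
  apply: continuous_L1loc => S S0 x.
  apply: (@continuous_comp (subspace `[0, S]) _ _ (K n) F x); last exact: cF.
  exact: IH.
move=> x; apply: cvgB; last exact: primitive_continuous.
by apply: cvgD; [exact: cvg_cst|exact: primitive_continuous].
Qed.

Let FK_L1loc n : L1loc (F \o K n).
Proof.
apply: continuous_L1loc => T T0 x.
apply: (@continuous_comp (subspace `[0, T]) _ _ (K n) F x); last exact: cF.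
exact: K_continuous.
Qed.

Let K_nd n (t : R) : 0 <= t -> K n t <= K n.+1 t.
Proof.
elim: n t => [|n IH] t t0.
  by rewrite /= (trajectory_integral _ _ _ _ _ cF cl tk t0) lerD2l lerN2 c1_le.
rewrite /= lerD2r lerD2l.
apply: (primitive_le (F \o K n) (F \o K n.+1)) => // s s0; apply: ndF; exact: IH.
Qed.

Let K_mono (t : R) : 0 <= t -> nondecreasing_seq (K ^~ t).
Proof. by move=> t0; apply/nondecreasing_seqP => n; exact: K_nd. Qed.

Let K_ge0 n (t : R) : 0 <= t -> 0 <= K n t.
Proof.
by move=> t0; apply: le_trans (k_ge0 _ t0) _; apply: (K_mono _ t0 0%N n).
Qed.

Let K_le_M n (t : R) : 0 <= t -> K n t <= M t.
Proof.
elim: n t => [|n IH] t t0; first exact: k_le_M.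
(* [M] solves the linear equation with [C * x] in place of [F x] and no consumption, hence dominates
   each iterate in turn. *)
have -> : M t = k0 + I (fun s => C * k0 * expR (C * s)) t.
  by rewrite primitive_expRM// addrC subrK.
rewrite /= -[leRHS]subr0 lerB ?c1_ge0// lerD2l.
apply: primitive_le => // [|s s0]; first exact: L1loc_expRM.
by apply: le_trans (FC _ (K_ge0 _ _ s0)) _; rewrite -mulrA ler_pM2l// IH.
Qed.

Let Kinf (t : R) := limn (K ^~ t).

Let K_cvg (t : R) : 0 <= t -> K ^~ t @ \oo --> Kinf t.
Proof.
move=> t0; apply: nondecreasing_is_cvgn; first exact: K_mono.
by exists (M t) => _ [n _ <-]; exact: K_le_M.
Qed.

Let FK_cvg (t : R) : 0 <= t -> (fun n => F (K n t)) @ \oo --> F (Kinf t).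
Proof. by move=> t0; apply: continuous_cvg; [exact: cF|exact: K_cvg]. Qed.

Let FKinf_dct (t : R) : 0 <= t -> mu.-integrable `[0, t] (EFin \o (F \o Kinf)) /\
  (fun n => I (F \o K n) t) @ \oo --> I (F \o Kinf) t.
Proof.
move=> t0.
have mFK n : measurable_fun `[0, t] (F \o K n).
  by have /integrableP[/measurable_EFinP] := FK_L1loc n t t0.
have mFKinf : measurable_fun `[0, t] (F \o Kinf).
  apply: (@measurable_fun_cvg _ _ _ _ (fun n => F \o K n)) => // s /=.
  by rewrite in_itv/= => /andP[s0 _]; exact: FK_cvg.
(* This is [C * M], which dominates [F (K n s)] for all [n]. *)
pose bound (s : R) := C * k0 * expR (C * s).
have [|||||iF _ cvgI] := @dominated_convergence _ _ _ mu `[0, t] (measurable_itv _)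
    (fun n => EFin \o (F \o K n)) (EFin \o (F \o Kinf)) (EFin \o bound).
- by move=> n; apply/measurable_EFinP; exact: mFK.
- by apply/measurable_EFinP.
- apply: aeW => s /=; rewrite in_itv/= => /andP[s0 _].
  by apply: cvg_EFin; [exact: nearW|exact: FK_cvg].
- exact: (L1loc_expRM C (C * k0)).
- apply: aeW => s n /=; rewrite in_itv/= => /andP[s0 _].
  rewrite lee_fin ger0_norm; last exact/F_ge0/K_ge0.
  apply: le_trans (FC _ (K_ge0 _ _ s0)) _.
  by rewrite /bound -mulrA ler_pM2l// K_le_M.
split=> //; apply: fine_cvg; rewrite /Rintegral fineK//.
exact: integrable_fin_num.
Qed.

Lemma iteration_limit : exists2 k1, trajectory F k0 c1 k1 &
  forall t, 0 <= t -> 0 <= k1 t.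
Proof.
(* One more application of [picard] makes the integral equation hold at every real time, once [k1]
   and [Kinf] agree at nonnegative times. *)
pose k1 := picard Kinf.
have k1E (t : R) : 0 <= t -> k1 t = Kinf t.
  move=> t0; have : (fun n => K n.+1 t) @ \oo --> k1 t.
    apply: cvgB; last exact: cvg_cst.
    by apply: cvgD; [exact: cvg_cst|have [] := FKinf_dct t t0].
  rewrite (cvg_shiftS (K ^~ t)) => Kk1.
  exact: cvg_unique Kk1 (K_cvg _ t0).
have IE t : I (F \o k1) t = I (F \o Kinf) t.
  by apply: eq_Rintegral => s; rewrite inE/= in_itv/= => /andP[s0 _]; rewrite /= k1E.
exists k1; last first.
  move=> t t0; rewrite k1E//; apply: limr_ge; first by apply: cvgP; exact: K_cvg.
  by apply: nearW => n; exact: K_ge0.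
apply: integral_trajectory => //.
  move=> T T0; apply: eq_integrable (FKinf_dct T T0).1 => // s.
  by rewrite inE/= in_itv/= => /andP[s0 _]; rewrite k1E.
by move=> t; rewrite IE.
Qed.

End MonotoneIteration.

(** * Comparison of integrals without measurability of the smaller integrand *)

Section NonmeasurableIntegrand.
Import HBNNSimple.

(* [f] need not be measurable: its integral is still a supremum over simple
   functions, which only see [f] outside of null sets. *)
Lemma le_integral_nonmeasurable d (T : measurableType d) (R : realType)
    (mu : {measure set T -> \bar R}) (D : set T) (f g : T -> \bar R) :
  measurable D -> measurable_fun D g -> (forall x, D x -> (0 <= g x)%E) ->
  {ae mu, forall x, D x -> (f x <= g x)%E} ->
  (\int[mu]_(x in D) f x <= \int[mu]_(x in D) g x)%E.
Proof.
move=> mD mg g0 fg.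
have -> : (\int[mu]_(x in D) g x = \int[mu]_x (g \_ D) x)%E by rewrite -integral_mkcond.
(* The negative part of [f] only lowers its integral and is dropped. *)
rewrite integralE; apply: (@le_trans _ _ (\int[mu]_(x in D) f^\+ x)%E).
  by rewrite -[leRHS]adde0 leeD2l// oppe_le0 integral_ge0.
rewrite ge0_integralE//; apply: ge_ereal_sup => _ [h /= hf <-].
have -> : sintegral mu h = (\int[mu]_x (h x)%:E)%E by rewrite integral_nnsfun// patch_setT.
apply: ae_ge0_le_integral => //.
- by move=> x _; rewrite lee_fin.
- exact/measurable_EFinP.
- by move=> x _; apply: erestrict_ge0.
- by apply/(measurable_restrictT _ _).1.
- case: fg => N [mN N0 fgN]; exists N; split=> // x /= nle; apply: fgN => /= fgx.
  apply: nle => _; apply: le_trans (hf x) _; rewrite !patchE.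
  case: ifPn => // /set_mem Dx; rewrite funeposE ge_max g0// andbT; exact: fgx.
Qed.

End NonmeasurableIntegrand.

(** * Monotonicity and linear growth of the production function *)

Section Production.
Context {R : realType} (F : R -> R) (L kl ku : R).
Hypothesis hF : production_function F L kl ku.

Lemma production_continuous : continuous F.
Proof.
move=> x; apply: differentiable_continuous; apply/derivable1_diffP.
exact: prod_derivable hF x.
Qed.

Lemma production_MVT (x y : R) : x < y ->
  exists2 z, x < z < y & F y - F x = derive1 F z * (y - x).
Proof.
move=> xy; have [||z] := @MVT R F (derive1 F) x y xy.
- by move=> z _; apply: derivable_is_derive; exact: prod_derivable hF z.
- by apply: continuous_subspaceT; exact: production_continuous.
- by rewrite in_itv/=; exists z.
Qed.

Lemma production_nd : {homo F : x y / x <= y}.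
Proof.
move=> x y; rewrite le_eqVlt => /predU1P[->//|xy].
have [z _ Fxy] := production_MVT _ _ xy.
by rewrite -subr_ge0 Fxy mulr_ge0 ?subr_ge0 ?ltW// (prod_derive_gt0 hF).
Qed.

Lemma production_ge0 x : 0 <= x -> 0 <= F x.
Proof. by move=> /production_nd; rewrite (prod_0 hF). Qed.

(** The derivative of [F] is bounded on [[0, +oo[]: beyond some point it is within 1 of [L], and
    before that it is continuous on a compact interval. The mean value theorem from [F 0 = 0]
    concludes. *)
Lemma production_linear : exists2 C, 0 < C & forall x : R, 0 <= x -> F x <= C * x.
Proof.
have /cvgrPdist_le/(_ _ ltr01)[A [_ hA]] := prod_derive_cvg hF.
have [z _ hz] : exists2 c, c \in `[0, `|A| + 1]%R &
    forall t, t \in `[0, `|A| + 1]%R -> derive1 F t <= derive1 F c.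
  by apply: EVT_max; [rewrite addr_ge0|apply: continuous_subspaceT; exact: prod_C1 hF].
have L0 := prod_L_gt0 hF.
have F'z := prod_derive_gt0 hF z.
exists (L + 1 + derive1 F z); first lra.
move=> x; rewrite le_eqVlt => /predU1P[<-|x0]; first by rewrite (prod_0 hF) mulr0.
have [y /andP[y0 yx]] := production_MVT _ _ x0.
rewrite (prod_0 hF) !subr0 => ->; rewrite ler_pM2r//.
have [yA|yA] := leP y (`|A| + 1).
  by apply: le_trans (hz y _) _; rewrite ?in_itv/= ?yA ?(ltW y0)//; lra.
have := hA y; rewrite /= (le_lt_trans (ler_norm A))//; last lra.
by move=> /(_ isT); rewrite ler_norml => /andP[? _]; lra.
Qed.

End Production.

(** * Chord inequalities and unit slopes of the utility *)

Section Utility.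
Context {R : realType} (u : R -> R).
Hypothesis hu : utility_function u.

Lemma utility_ltr x y : 0 <= x -> x < y -> u x < u y.
Proof.
move=> x0 xy; apply: (util_increasing hu) => //; rewrite inE/= in_itv/= andbT//.
by rewrite (le_trans x0)// ltW.
Qed.

Lemma utility_ler x y : 0 <= x -> x <= y -> u x <= u y.
Proof.
move=> x0; rewrite le_eqVlt => /predU1P[->//|xy].
exact/ltW/utility_ltr.
Qed.

Lemma utility_ge0 x : 0 <= x -> 0 <= u x.
Proof. by move=> x0; rewrite -(util_0 hu) utility_ler. Qed.

(** Slopes of adjacent chords, cleared of denominators: concavity at [b], which is the combination
    of [a] and [c] with weight [(c - b) / (c - a)] on [a]. *)
Lemma utility_chord3 a b c : 0 <= a -> a < b -> b < c ->
  (b - a) * (u c - u b) <= (c - b) * (u b - u a).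
Proof.
move=> a0 ab bc; have ca : 0 < c - a by lra.
have := @util_strictly_concave _ _ hu a c ((c - b) / (c - a)).
have E1 : 1 - (c - b) / (c - a) = (b - a) / (c - a) by field; lra.
rewrite E1 => H.
have {H} : (c - b) / (c - a) * u a + (b - a) / (c - a) * u c <= u b.
  rewrite [leRHS](_ : u b = u ((c - b) / (c - a) * a + (b - a) / (c - a) * c)).
    apply/ltW/H; rewrite /= ?in_itv/= ?andbT//; [lra|by rewrite lt_eqF//; lra|].
    apply/andP; split; first by rewrite divr_gt0// subr_gt0.
    by rewrite ltr_pdivrMr// mul1r; lra.
  by congr u; field; lra.
rewrite -(ler_pM2l ca).
rewrite [leLHS](_ : _ = (c - b) * u a + (b - a) * u c); last by field; lra.
by move=> H; nra.
Qed.

(** The slope over [[b, c]] lies between the other two; the product form also covers degenerate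
    chords. *)
Lemma utility_chord4 a b c d : 0 <= a -> a <= b -> b <= c -> c <= d ->
  (b - a) * (u d - u c) <= (d - c) * (u b - u a).
Proof.
move=> a0; rewrite le_eqVlt => /predU1P[->|ab]; first by rewrite !subrr mul0r mulr0.
move=> bc; rewrite le_eqVlt => /predU1P[->|cd]; first by rewrite !subrr mul0r mulr0.
move: bc cd; rewrite le_eqVlt => /predU1P[<-|bc] cd; first exact: utility_chord3.
have b0 : 0 <= b by lra.
have h1 := utility_chord3 _ _ _ a0 ab bc.
have h2 := utility_chord3 _ _ _ b0 bc cd.
have cb : 0 < c - b by lra.
rewrite -(ler_pM2l cb); nra.
Qed.

(** A unit chord replaces the derivative, so that the chord inequalities apply directly, including
    at 0. *)
Definition slope x := u (x + 1) - u x.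

Lemma slope_gt0 x : 0 <= x -> 0 < slope x.
Proof. by move=> x0; rewrite subr_gt0 utility_ltr// ltrDl. Qed.

Lemma slope_noninc x y : 0 <= x -> x <= y -> slope y <= slope x.
Proof.
move=> x0 xy; rewrite /slope; have [xy1|xy1] := leP (x + 1) y.
  have y1 : y <= y + 1 by lra.
  have x1 : x <= x + 1 by lra.
  have := utility_chord4 _ _ _ _ x0 x1 xy1 y1; lra.
(* When the two unit intervals overlap, the chords to compare are those over [[x, y]] and
   [[x + 1, y + 1]], of equal length. *)
move: xy; rewrite le_eqVlt => /predU1P[->//|xy].
have xy2 : x + 1 <= y + 1 by lra.
have := utility_chord4 _ _ _ _ x0 (ltW xy) (ltW xy1) xy2.
rewrite (_ : y + 1 - (x + 1) = y - x); last lra.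
rewrite ler_pM2l ?subr_gt0//; lra.
Qed.

(** By the mean value theorem the slope at [x] is a value of the derivative beyond [x], and the
    derivative tends to 0. *)
Lemma slope_cvg0 e : 0 < e -> exists2 x, 0 <= x & slope x <= e.
Proof.
move=> e0; have /cvgrPdist_le/(_ _ e0)[A [_ hA]] := util_derive_cvgy hu.
have x0 : 0 < `|A| + 1 by rewrite ltr_wpDl.
exists (`|A| + 1); first exact: ltW.
set x := `|A| + 1 in x0 *.
have xx1 : x < x + 1 by rewrite ltrDl.
have du z : x <= z -> is_derive z 1 u (derive1 u z).
  by move=> xz; apply/derivable_is_derive/(util_derivable hu)/(lt_le_trans x0).
have [||z] := @MVT R u (derive1 u) x (x + 1) xx1.
- by move=> z; rewrite in_itv/= => /andP[/ltW xz _]; exact: du.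
- apply: derivable_within_continuous => z; rewrite in_itv/= => /andP[xz _].
  by case: (du z xz).
have -> : x + 1 - x = 1 by rewrite addrAC subrr add0r.
rewrite in_itv/= mulr1 => /andP[xz _] uE.
rewrite /slope uE; have := hA z; rewrite /= sub0r normrN.
rewrite (lt_trans _ xz); last by rewrite /x (le_lt_trans (ler_norm A))// ltrDl.
by move=> /(_ isT); apply: le_trans; exact: ler_norm.
Qed.

Lemma utility_measurable : measurable_fun (`[0, +oo[ : set R) u.
Proof.
by apply: subspace_continuous_measurable_fun => //; exact: util_continuous hu.
Qed.

End Utility.

(** * Closure properties of local integrability *)

Section L1locFacts.
Context {R : realType}.
Implicit Types (g h : R -> R).
Local Notation mu := (@lebesgue_measure R).
Local Notation I g t := (\int[mu]_(s in `[0, t]) g s).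

Lemma L1loc_measurable g : L1loc g -> measurable_fun (`[0, +oo[ : set R) g.
Proof.
by move=> gl; apply/(measurable_restrictT _ _).2 => //; case: (L1loc_locally_integrable g gl).
Qed.

Lemma L1loc_dominated g h : L1loc g -> measurable_fun (`[0, +oo[ : set R) h ->
  (forall t, 0 <= t -> `|h t| <= `|g t|) -> L1loc h.
Proof.
move=> gl mh hg T T0; apply: le_integrable (gl T T0) => //.
  apply/measurable_EFinP; apply: measurable_funS mh => // t /=.
  by rewrite !in_itv/= andbT => /andP[].
by move=> t /=; rewrite in_itv/= lee_fin => /andP[t0 _]; exact: hg.
Qed.

Lemma L1locD g h : L1loc g -> L1loc h -> L1loc (g \+ h).
Proof.
move=> hg hh T T0; rewrite (_ : _ \o _ = ((EFin \o g) \+ (EFin \o h))%E)//.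
by apply: integrableD => //; [exact: hg|exact: hh].
Qed.

Lemma L1loc_patch g (D : set R) : measurable D -> L1loc g -> L1loc (g \_ D).
Proof.
move=> mD gl T T0; rewrite -restrict_EFin; apply/integrable_restrict => //=.
by apply: (integrableS _ _ _ (gl T T0)) => //; exact: measurableI.
Qed.

Lemma L1loc_cst (r : R) : L1loc (cst r).
Proof.
by apply: continuous_L1loc => T _; apply: continuous_subspaceT; exact: cst_continuous.
Qed.

End L1locFacts.

(** * The truncated control and its primitive *)

Section Truncation.
Context {R : realType} (c : R -> R) (N T : R).
Local Notation mu := (@lebesgue_measure R).
Local Notation I g t := (\int[mu]_(s in `[0, t]) g s).

Hypothesis c_ge0 : forall t, 0 <= c t.
Hypothesis cl : L1loc c.
Hypothesis N_ge0 : 0 <= N.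
Hypothesis T_ge0 : 0 <= T.

(** This is the positive part of [c - N]. *)
Definition excess (t : R) : R := c t - Num.min (c t) N.

Definition saved : R := I excess T.

(* What is cut off on [0, T] is consumed at a constant rate on ]T, T + 1]. *)
Definition reallocated (t : R) : R :=
  c t - (excess \_ `]-oo, T]) t + (cst saved \_ `]T, T + 1]) t.

Lemma excess_ge0 t : 0 <= excess t.
Proof. by rewrite subr_ge0 ge_min lexx. Qed.

Lemma excess_le t : excess t <= c t.
Proof. by rewrite gerBl le_min c_ge0. Qed.

Lemma excess_L1loc : L1loc excess.
Proof.
apply: L1loc_dominated cl _ _ => [|t _].
  apply: measurable_funB; first exact: L1loc_measurable.
  apply: measurable_minr; [exact: L1loc_measurable|exact: measurable_cst].
by rewrite !ger0_norm ?excess_ge0// excess_le.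
Qed.

Lemma saved_ge0 : 0 <= saved.
Proof. by apply: Rintegral_ge0 => t _; exact: excess_ge0. Qed.

Lemma saved_le : saved <= I c T.
Proof.
by apply: primitive_le => //; [exact: excess_L1loc|move=> s _; exact: excess_le].
Qed.

Lemma reallocatedE1 t : t <= T -> reallocated t = Num.min (c t) N.
Proof.
move=> tT; rewrite /reallocated !patchE mem_set ?memNset/= ?in_itv/=.
- by rewrite addr0 /excess opprB addrC subrK.
- by rewrite ltNge tT.
- exact: tT.
Qed.

Lemma reallocatedE2 t : T < t -> t <= T + 1 -> reallocated t = c t + saved.
Proof.
move=> Tt tT1; rewrite /reallocated !patchE memNset ?mem_set/= ?in_itv/=.
- by rewrite subr0.
- by rewrite Tt.
- by rewrite leNgt Tt.
Qed.

Lemma reallocatedE3 t : T + 1 < t -> reallocated t = c t.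
Proof.
move=> Tt; rewrite /reallocated !patchE memNset ?memNset/= ?in_itv/=.
- by rewrite subr0 addr0.
- by rewrite (leNgt t) Tt andbF.
- by rewrite leNgt (lt_trans _ Tt)// ltrDl.
Qed.

Lemma reallocated_ge0 t : 0 <= reallocated t.
Proof.
have [tT|Tt] := leP t T; first by rewrite reallocatedE1// le_min c_ge0.
have [tT1|T1t] := leP t (T + 1); last by rewrite reallocatedE3.
by rewrite reallocatedE2// addr_ge0// saved_ge0.
Qed.

Let excess_patch_L1loc : L1loc (excess \_ `]-oo, T]).
Proof. by apply: L1loc_patch => //; exact: excess_L1loc. Qed.

Let saved_patch_L1loc : L1loc (cst saved \_ `]T, T + 1]).
Proof. by apply: L1loc_patch => //; exact: L1loc_cst. Qed.

Lemma reallocated_L1loc : L1loc reallocated.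
Proof. by apply: L1locD => //; exact: L1locB. Qed.

(** Up to [T] consumption is only cut; after [T] all of [saved] has been withheld, and at most that
    much is returned because []T, T + 1]] has length 1. *)
Lemma primitive_reallocated_le t : 0 <= t -> I reallocated t <= I c t.
Proof.
move=> t0; rewrite /reallocated.
rewrite RintegralD//; [|exact: L1loc_integrable (L1locB _ _ cl excess_patch_L1loc)|
  exact: L1loc_integrable].
rewrite RintegralB//; [|exact: L1loc_integrable..].
rewrite -addrA gerDl addrC subr_le0 -!Rintegral_mkcondr Rintegral_cst; last exact: measurableI.
have [tT|Tt] := leP t T.
  rewrite [X in fine X](_ : _ = 0%E) ?mulr0.
    by apply: Rintegral_ge0 => s _; exact: excess_ge0.
  rewrite -[RHS](measure0 mu); congr (mu _).
  apply/seteqP; split=> // s [] /=; rewrite !in_itv/= => /andP[_ st] /andP[Ts _].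
  by have := lt_le_trans Ts (le_trans st tT); rewrite ltxx.
rewrite [X in _ <= \int[mu]_(x in X) _](_ : _ = `[0, T]); last first.
  apply/seteqP; split => s /=; rewrite !in_itv/=; first by case=> /andP[-> _] ->.
  by move=> /andP[-> sT]; rewrite (le_trans sT (ltW Tt)).
rewrite -[leRHS]mulr1 ler_wpM2l ?saved_ge0//.
have muT : mu `]T, T + 1]%classic = 1%E.
  by rewrite lebesgue_measure_itv/= lte_fin ltrDl ltr01 -EFinD addrAC subrr add0r.
rewrite -[leRHS](_ : fine (mu `]T, T + 1]%classic) = 1); last by rewrite muT.
apply: fine_le; rewrite ?muT//; last first.
  by rewrite -muT le_measure ?inE//; exact: measurableI.
by rewrite ge0_fin_numE// (@le_lt_trans _ _ 1%E) ?ltry// -muT le_measure ?inE//; exact: measurableI.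
Qed.

End Truncation.

(** * Comparison of the utilities of the two controls *)

Section UtilityGain.
Context {R : realType} (u c : R -> R) (rho N T B : R).
Local Notation mu := (@lebesgue_measure R).
Local Notation I g t := (\int[mu]_(s in `[0, t]) g s).
Local Notation cT := (reallocated c N T).
Local Notation delta := (saved c N T).
(** A lower bound for the discounted gain per unit of [delta] at times of []T, T + 1]] when
    [c <= 2 * B]: as [delta <= B], consumption then stays below [3 * B]. *)
Local Notation kappa := (expR (- (rho * (T + 1))) * slope u (3 * B)).
Local Notation payoff c t := (expR (- (rho * t)) * u (c t)).

Hypothesis hu : utility_function u.
Hypothesis c_ge0 : forall t, 0 <= c t.
Hypothesis cl : L1loc c.
Hypothesis rho_ge0 : 0 <= rho.
Hypothesis N_ge0 : 0 <= N.
Hypothesis T_ge0 : 0 <= T.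
Hypothesis B_gt0 : 0 < B.
Hypothesis c_le_B : I c (T + 1) <= B.
Hypothesis uN : forall x, N <= x -> u x - u N <= (x - N) * (kappa / 2).

Let kappa_ge0 : 0 <= kappa.
Proof. by rewrite mulr_ge0 ?expR_ge0// ltW// slope_gt0// mulr_ge0// ltW. Qed.

Lemma payoff_ge0 (h : R -> R) t : 0 <= h t -> 0 <= payoff h t.
Proof. by move=> h0; rewrite mulr_ge0 ?expR_ge0// utility_ge0. Qed.

Lemma payoff_measurable (h : R -> R) : (forall t, 0 <= h t) -> L1loc h ->
  measurable_fun (`[0, +oo[ : set R) (fun t => payoff h t).
Proof.
move=> h0 hl; apply: measurable_funM.
  apply: measurable_funTS; apply: continuous_measurable_fun.
  under eq_fun do rewrite -mulNr; exact: continuous_expRM.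
apply: (@measurable_comp _ _ _ _ _ _ (`[0, +oo[ : set R)) => //.
- by move=> _ [t _ <-] /=; rewrite in_itv/= h0.
- exact: utility_measurable.
- exact: L1loc_measurable.
Qed.

Let cT_ge0 t : 0 <= cT t. Proof. exact: reallocated_ge0. Qed.
Let cTl : L1loc cT. Proof. exact: reallocated_L1loc. Qed.
Let delta_ge0 : 0 <= delta. Proof. exact: saved_ge0. Qed.

Let delta_le_B : delta <= B.
Proof.
apply: le_trans (saved_le _ _ _ c_ge0 cl N_ge0) _; apply: le_trans c_le_B.
rewrite -subr_ge0 primitiveB// ?lerDl//.
by apply: Rintegral_ge0 => t _; exact: c_ge0.
Qed.

(** Discounting only reduces the loss, and chords of [u] starting at [N] have slope at most
    [kappa / 2]. *)
Lemma payoff_loss t : 0 <= t -> t <= T ->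
  payoff c t <= payoff cT t + kappa / 2 * excess c N t.
Proof.
move=> t0 tT; rewrite reallocatedE1// /excess.
have [cN|Nc] := leP (c t) N; first by rewrite subrr mulr0 addr0.
have e1 : expR (- (rho * t)) <= 1 by rewrite -expR0 ler_expR oppr_le0 mulr_ge0.
have e0 := expR_ge0 (- (rho * t)).
have un := uN _ (ltW Nc).
rewrite -lerBlDl -mulrBr; apply: (@le_trans _ _ (1 * (u (c t) - u N))).
  by apply: ler_wpM2r => //; rewrite subr_ge0 utility_ler// ltW.
by rewrite mul1r mulrC.
Qed.

(* The last term makes the inequality trivial when [2 * B < c t]; as the
   integral of [c] is at most [B], it costs only half of the gain. *)
Lemma payoff_gain t : T < t -> t <= T + 1 ->
  payoff c t + kappa * delta <=
  payoff cT t + kappa * delta / (2 * B) * c t.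
Proof.
move=> Tt tT; rewrite reallocatedE2//.
have e0 := expR_ge0 (- (rho * t)).
have kd0 : 0 <= kappa * delta by rewrite mulr_ge0.
have up : u (c t) <= u (c t + delta) by rewrite utility_ler// lerDl.
have [cB|Bc] := leP (c t) (2 * B); last first.
  apply: lerD; first exact: ler_wpM2l.
  have : 1 <= (2 * B)^-1 * c t by rewrite mulrC ler_pdivlMr ?mul1r ?(ltW Bc)// mulr_gt0.
  by move: (kappa * delta) kd0 => K K0 hB; rewrite -mulrA ler_peMr.
(* Concavity compares the chord over [[c t, c t + delta]] with the unit chord starting at
   [3 * B]. *)
have : kappa * delta <= expR (- (rho * t)) * (u (c t + delta) - u (c t)).
  rewrite -mulrA ler_pM ?expR_ge0//.
  - by rewrite mulr_ge0// ltW// slope_gt0// mulr_ge0// ltW.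
  - by rewrite ler_expR lerN2 ler_wpM2l.
  - have h1 : c t <= c t + delta by rewrite lerDl.
    have h2 : c t + delta <= 3 * B.
      by apply: le_trans (lerD cB delta_le_B) _; rewrite [_ * B + B](_ : _ = 3 * B)//; ring.
    have h3 : 3 * B <= 3 * B + 1 by rewrite lerDl.
    have := utility_chord4 _ hu _ _ _ _ (c_ge0 t) h1 h2 h3.
    by rewrite !(addrAC _ _ (- _)) !subrr !add0r mul1r mulrC.
have : 0 <= kappa * delta / (2 * B) * c t.
  by rewrite mulr_ge0// divr_ge0// mulr_ge0// ltW.
rewrite mulrBr; lra.
Qed.

Let J (D : set R) (f : R -> R) : \bar R := (\int[mu]_(t in D) (f t)%:E)%E.

Let JD (D : set R) (f g : R -> R) : measurable D -> D `<=` `[0, +oo[ ->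
  measurable_fun (`[0, +oo[ : set R) f -> measurable_fun (`[0, +oo[ : set R) g ->
  (forall t, D t -> 0 <= f t) -> (forall t, D t -> 0 <= g t) ->
  J D (f \+ g) = (J D f + J D g)%E.
Proof.
move=> mD D0 mf mg f0 g0; rewrite /J /=.
under eq_integral do rewrite EFinD.
rewrite ge0_integralD//.
- by apply/measurable_EFinP; exact: measurable_funS mf.
- by apply/measurable_EFinP; exact: measurable_funS mg.
Qed.

Let J_le (D : set R) (f g : R -> R) : measurable D -> D `<=` `[0, +oo[ ->
  measurable_fun (`[0, +oo[ : set R) f -> measurable_fun (`[0, +oo[ : set R) g ->
  (forall t, D t -> 0 <= f t) -> (forall t, D t -> f t <= g t) ->
  (J D f <= J D g)%E.
Proof.
move=> mD D0 mf mg f0 fg; apply: ge0_le_integral => //.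
- by apply/measurable_EFinP; exact: measurable_funS mf.
- by apply/measurable_EFinP; exact: measurable_funS mg.
Qed.

Let JZ (T1 : R) (D : set R) (r : R) (h : R -> R) : measurable D -> D `<=` `[0, T1] -> L1loc h ->
  J D (fun t => r * h t) = (r * \int[mu]_(t in D) h t)%:E.
Proof.
move=> mD DT hl; have hi : mu.-integrable D (EFin \o h).
  by apply: integrableS (L1loc_integrable h T1 hl).
rewrite EFinM /Rintegral fineK; last exact: integrable_fin_num.
by rewrite -integralZl.
Qed.

Let D1 : set R := `[0, T].
Let D2 : set R := `]T, T + 1].
Let D3 : set R := `]T + 1, +oo[.
Let mD1 : measurable D1. Proof. exact: measurable_itv. Qed.
Let mD2 : measurable D2. Proof. exact: measurable_itv. Qed.
Let mD3 : measurable D3. Proof. exact: measurable_itv. Qed.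

Let splitJ (h : R -> R) : (forall t, 0 <= h t) -> L1loc h ->
  utility_functional u rho h =
  (J D1 (fun t => payoff h t) + (J D2 (fun t => payoff h t) + J D3 (fun t => payoff h t)))%E.
Proof.
move=> h0 hl; have mp := payoff_measurable _ h0 hl.
have E23 : D2 `|` D3 = `]T, +oo[.
  by rewrite /D2 /D3 -itv_bndbnd_setU// bnd_simp lerDl.
have E : (`[0, +oo[ : set R) = D1 `|` (D2 `|` D3).
  by rewrite E23 /D1 -itv_bndbnd_setU.
rewrite /utility_functional E ge0_integral_setU//.
- congr (_ + _)%E; rewrite ge0_integral_setU//.
  + apply/measurable_EFinP; apply: measurable_funS mp => //.
    by rewrite E; exact: subsetUr.
  + by move=> t _; rewrite lee_fin payoff_ge0.
  + apply/disj_set2P; apply/seteqP; split=> // t []; rewrite /D2 /D3 /= !in_itv/= andbT.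
    by move=> /andP[_ tT] Tt; have := le_lt_trans tT Tt; rewrite ltxx.
- by rewrite E23.
- by rewrite -E; apply/measurable_EFinP.
- by move=> t _; rewrite lee_fin payoff_ge0.
- apply/disj_set2P; rewrite E23; apply/seteqP; split=> // t []; rewrite /D1 /= !in_itv/= andbT.
  by move=> /andP[_ tT] Tt; have := le_lt_trans tT Tt; rewrite ltxx.
Qed.

(** The loss on [D1] is at most [kappa * delta / 2], the net gain on [D2] is at least as much, and
    the controls agree on [D3]. *)
Lemma utility_reallocated :
  (utility_functional u rho c <= utility_functional u rho cT)%E.
Proof.
rewrite !splitJ//.
have mc := payoff_measurable _ c_ge0 cl.
have mcT := payoff_measurable _ cT_ge0 cTl.
have el := excess_L1loc c N c_ge0 cl N_ge0.
have D1T : D1 `<=` `[0, T] by [].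
have D2T : D2 `<=` `[0, T + 1].
  by move=> t; rewrite /D2 /= !in_itv/= => /andP[/ltW/(le_trans T_ge0)->].
have to0 S : `[0, S] `<=` (`[0, +oo[ : set R).
  by move=> t /=; rewrite !in_itv/= andbT => /andP[].
have mM r h : L1loc h -> measurable_fun (`[0, +oo[ : set R) (fun t => r * h t).
  by move=> /L1loc_measurable mh; apply: measurable_funM.
have k20 : 0 <= kappa / 2 by rewrite divr_ge0.
have ineq1 : (J D1 (fun t => payoff c t) <=
    J D1 (fun t => payoff cT t) + (kappa / 2 * delta)%:E)%E.
  rewrite /saved -(JZ T D1)// -JD//.
  - apply: J_le => //; first exact: to0.
    + by apply: measurable_funD => //; exact: mM.
    + by move=> t _; exact: payoff_ge0.
    + by move=> t; rewrite /D1 /= in_itv/= => /andP[t0 tT]; exact: payoff_loss.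
  - exact: to0.
  - exact: mM.
  - by move=> t _; exact: payoff_ge0.
  - by move=> t _; rewrite mulr_ge0// excess_ge0.
(* Chosen so that [r * B] is half of [kappa * delta]. *)
pose r := kappa * delta / (2 * B).
have kd0 : 0 <= kappa * delta := mulr_ge0 kappa_ge0 delta_ge0.
have r0 : 0 <= r by apply: divr_ge0 => //; apply: mulr_ge0 => //; exact: ltW.
have cD2 : \int[mu]_(t in D2) c t <= B.
  rewrite -primitiveB// ?lerDl//; apply: le_trans c_le_B.
  by rewrite gerBl; apply: Rintegral_ge0.
have muD2 : mu D2 = 1%E.
  by rewrite lebesgue_measure_itv/= lte_fin ltrDl ltr01 -EFinD addrAC subrr add0r.
(* The gain is split into two halves: one pays for the correction term of [payoff_gain], the other
   for the loss on [D1]. *)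
have ineq2 : (J D2 (fun t => payoff c t) + (kappa * delta / 2 + kappa * delta / 2)%:E <=
    J D2 (fun t => payoff cT t) + (kappa * delta / 2)%:E)%E.
  rewrite -splitr.
  apply: (@le_trans _ _ (J D2 (fun t => payoff cT t) + J D2 (fun t => (r * c t)%R))%E).
    have -> : (kappa * delta)%:E = J D2 (fun t => kappa * delta * cst 1 t).
      rewrite (JZ (T + 1))//; last exact: L1loc_cst.
      by rewrite Rintegral_cst// [X in fine X]muD2 !mulr1.
    rewrite -!JD//.
    + apply: J_le => //.
      * exact: subset_trans D2T (to0 _).
      * by apply: measurable_funD => //; apply: mM; exact: L1loc_cst.
      * by apply: measurable_funD => //; exact: mM.
      * by move=> t _; rewrite /= addr_ge0 ?payoff_ge0// mulr1.
      * move=> t; rewrite /D2 /= in_itv/= mulr1 => /andP[Tt tT]; exact: payoff_gain.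
    + exact: subset_trans D2T (to0 _).
    + exact: mM.
    + by move=> t _; exact: payoff_ge0.
    + by move=> t _; rewrite mulr_ge0.
    + exact: subset_trans D2T (to0 _).
    + by apply: mM; exact: L1loc_cst.
    + by move=> t _; exact: payoff_ge0.
    + by move=> t _; rewrite mulr1.
  rewrite leeD2l// (JZ (T + 1))// lee_fin.
  apply: le_trans (ler_wpM2l r0 cD2) _.
  rewrite le_eqVlt; apply/orP; left; apply/eqP; rewrite /r; field; exact: lt0r_neq0.
have eq3 : J D3 (fun t => payoff c t) = J D3 (fun t => payoff cT t).
  apply: eq_integral => t; rewrite inE /D3 /= in_itv/= andbT => Tt.
  by rewrite reallocatedE3.
rewrite eq3; move: ineq1 ineq2.
have -> : kappa / 2 * delta = kappa * delta / 2 by rewrite mulrAC.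
move: (J D1 _) (J D1 _) (J D2 _) (J D2 _) (J D3 _) => g1 f1 g2 f2 x.
move: (kappa * delta / 2) => e le1 le2.
(* The integrals may be infinite, so only the real number [e] is cancelled. *)
have {}le2 : (f2 + e%:E <= g2)%E by rewrite -(@leeD2rE _ e%:E)// -addeA -EFinD.
rewrite !addeA leeD2r//; apply: le_trans (leeD le1 (lexx f2)) _.
by rewrite -addeA leeD2l// addeC.
Qed.

End UtilityGain.

(** * Admissibility under modification of the control *)

Section Admissibility.
Context {R : realType} (F : R -> R) (L kl ku : R).
Hypothesis hF : production_function F L kl ku.
Implicit Types (c h : R -> R).
Local Notation mu := (@lebesgue_measure R).
Local Notation I g t := (\int[mu]_(s in `[0, t]) g s).

(** Provides a representative that is nonnegative everywhere. At positive times it differs from [c]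
    only on a null set, so the trajectory is the same. *)
Lemma admissible_maxr0 (k0 : R) c :
  admissible F k0 c -> admissible F k0 (fun t => Num.max (c t) 0).
Proof.
move=> [cl cae [k tk k_ge0]]; split.
- apply: (L1loc_dominated _ _ cl) => [|t _].
    by apply: measurable_maxr; [exact: L1loc_measurable|exact: measurable_cst].
  rewrite ger0_norm ?le_max ?lexx ?orbT// ge_max ler_norm normr_ge0//.
- by apply: aeW => t _; rewrite le_max lexx orbT.
- exists k => //; split; [exact: traj_init tk|exact: (traj_ac tk)|].
  apply: ae_imply2 (traj_ode tk) cae => t dk c0 t0.
  by rewrite max_l ?c0 ?ltW//; exact: dk.
Qed.

(** Only the primitives are compared, so [h] may exceed [c] at some times: consumption may be
    postponed. *)
Lemma admissible_le (k0 : R) c h : admissible F k0 c -> L1loc h ->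
  (forall t, 0 <= h t) -> (forall t, 0 <= t -> I h t <= I c t) ->
  admissible F k0 h.
Proof.
move=> [cl _ [k tk k_ge0]] hl h0 hc.
have [C C0 FC] := production_linear _ _ _ _ hF.
split=> //; first exact: aeW.
apply: (@iteration_limit R F c h k C) => //.
- exact: production_continuous hF.
- exact: production_nd hF.
- exact: production_ge0 hF.
- by move=> t _; apply: Rintegral_ge0.
Qed.

Lemma admissible_growth C (k0 : R) c t : 0 < C ->
  (forall x : R, 0 <= x -> F x <= C * x) -> (forall t, 0 <= c t) ->
  admissible F k0 c -> 0 <= t -> I c t <= k0 * expR (C * t).
Proof.
move=> C0 FC c0 [cl _ [k tk k_ge0]] t0.
have Ic0 s : 0 <= s -> 0 <= I c s by move=> _; exact: Rintegral_ge0.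
have := trajectory_growth _ _ _ _ _ _ (production_continuous _ _ _ _ hF) C0 FC cl Ic0 tk k_ge0 t0.
by apply: le_trans; rewrite lerDr k_ge0.
Qed.

End Admissibility.

(** * The truncation level as a function of the gain rate *)

Section Threshold.
Context {R : realType} (u : R -> R).
Hypothesis hu : utility_function u.

(* The infimum need not be attained, hence one unit above it to enter the set,
   and one more to pass from the slope on [x, x + 1] to the slope beyond N. *)
Definition threshold (kappa : R) : R :=
  2 + inf [set x | 0 <= x /\ slope u x <= kappa / 2].

Lemma threshold_gt0 kappa : 0 < kappa -> 0 < threshold kappa.
Proof.
move=> k0; rewrite ltr_pwDl//; have [|x x0 sx] := slope_cvg0 _ hu (kappa / 2).
  by rewrite divr_gt0.
by apply: lb_le_inf; [exists x|move=> y []].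
Qed.

(** Lowering [kappa] shrinks the set whose infimum is taken. *)
Lemma threshold_noninc kappa1 kappa2 : 0 < kappa2 -> kappa2 <= kappa1 ->
  threshold kappa1 <= threshold kappa2.
Proof.
move=> k20 k21; rewrite lerD2l; have [|x x0 sx] := slope_cvg0 _ hu (kappa2 / 2).
  by rewrite divr_gt0.
apply: lb_le_inf; first by exists x.
move=> y [y0 sy]; apply: ge_inf; first by exists 0 => z [].
by split=> //; apply: le_trans sy _; rewrite ler_pM2r ?invr_gt0.
Qed.

Lemma threshold_slope kappa x : 0 < kappa -> threshold kappa <= x ->
  u x - u (threshold kappa) <= (x - threshold kappa) * (kappa / 2).
Proof.
move=> k0 Nx; have [|z z0 sz] := slope_cvg0 _ hu (kappa / 2).
  by rewrite divr_gt0.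
set S := [set x | 0 <= x /\ slope u x <= kappa / 2].
have hS : has_inf S by split; [exists z|exists 0 => y []].
(* A point [y] of the set less than one unit above the infimum: the whole chord over [[y, y + 1]]
   then lies below the threshold. *)
have [y [y0 sy] yN] := inf_adherent ltr01 hS.
have y1N : y + 1 <= threshold kappa.
  by rewrite /threshold; move: yN; rewrite -/S; move: (inf S) => i; lra.
have yy1 : y <= y + 1 by rewrite lerDl.
have := utility_chord4 _ hu _ _ _ _ y0 yy1 y1N Nx.
rewrite addrAC subrr add0r mul1r => /le_trans; apply.
by apply: ler_wpM2l => //; rewrite subr_ge0.
Qed.

End Threshold.

(** * Choice of the bound and verification of its properties *)

Theorem lemma9 (R : realType) (F u : R -> R) (L kl ku rho eps0 : R)
    (hF : production_function F L kl ku) (hu : utility_function u)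
    (hrho : 0 < rho) (heps0 : 0 < eps0)
    (hdisc : discount_condition u rho L eps0) :
  exists N : R -> R -> R,
    [/\ forall k0 T : R, 0 < k0 -> 0 < T -> 0 < N k0 T,
        forall k1 k2 T : R, 0 < k1 -> k1 <= k2 -> 0 < T -> N k1 T <= N k2 T,
        forall k0 T1 T2 : R, 0 < k0 -> 0 < T1 -> T1 <= T2 -> N k0 T1 <= N k0 T2 &
        forall k0 T : R, 0 < k0 -> 0 < T ->
        forall c : R -> R, admissible F k0 c ->
        exists cT : R -> R,
          [/\ admissible F k0 cT,
              (utility_functional u rho c <= utility_functional u rho cT)%E,
              {ae @lebesgue_measure R, forall t : R, 0 <= t <= T ->
                cT t = Num.min (c t) (N k0 T)} &
              {ae @lebesgue_measure R, forall t : R, 0 <= t <= T ->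
                cT t <= N k0 T}]].
Proof.
have [C C0 FC] := production_linear _ _ _ _ hF.
(* The growth bound for the integral of an admissible control over [[0, T + 1]]. *)
pose B k0 T := k0 * expR (C * (T + 1)).
have B_gt0 k0 T : 0 < k0 -> 0 < B k0 T by move=> ?; rewrite mulr_gt0 ?expR_gt0.
pose kappa k0 T := expR (- (rho * (T + 1))) * slope u (3 * B k0 T).
have kappa_gt0 k0 T : 0 < k0 -> 0 < kappa k0 T.
  by move=> k00; rewrite mulr_gt0 ?expR_gt0// slope_gt0// mulr_ge0// ltW// B_gt0.
(* Neither factor of [kappa] increases with [k0] or [T], because [B] grows with both; as [threshold]
   is nonincreasing, [N] is increasing in both variables. *)
have kappa_noninc k1 k2 T1 T2 : 0 < k1 -> k1 <= k2 -> T1 <= T2 ->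
    kappa k2 T2 <= kappa k1 T1.
  move=> k10 k12 T12; have B1 := B_gt0 k1 T1 k10.
  have k20 := lt_le_trans k10 k12.
  apply: ler_pM; rewrite ?expR_ge0//.
  - by rewrite ltW// slope_gt0// mulr_ge0// ltW// B_gt0.
  - by rewrite ler_expR lerN2 ler_pM2l// lerD2r.
  - apply: slope_noninc => //; first by rewrite mulr_ge0// ltW.
    rewrite ler_pM2l// ler_pM ?expR_ge0 ?(ltW k10)//.
    by rewrite ler_expR ler_pM2l// lerD2r.
exists (fun k0 T => threshold u (kappa k0 T)); split.
- by move=> k0 T k00 _; apply: threshold_gt0 => //; exact: kappa_gt0.
- move=> k1 k2 T k10 k12 _; apply: threshold_noninc => //.
    exact/kappa_gt0/(lt_le_trans k10).
  exact: kappa_noninc.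
- move=> k0 T1 T2 k00 _ T12; apply: threshold_noninc => //; first exact: kappa_gt0.
  exact: kappa_noninc.
move=> k0 T k00 T0 c adm_c; set N := threshold u _.
have N0 : 0 < N by apply: threshold_gt0 => //; exact: kappa_gt0.
pose c' t := Num.max (c t) 0.
have c'0 t : 0 <= c' t by rewrite le_max lexx orbT.
have adm_c' : admissible F k0 c' by exact: admissible_maxr0.
have cc' : {ae @lebesgue_measure R, forall t, 0 <= t -> c' t = c t}.
  by apply: ae_imply (adm_ge0 adm_c) => t + t0 => /(_ t0) ct; rewrite /c' max_l.
have c'l := adm_L1loc adm_c'.
have T_ge0 := ltW T0; have N_ge0 := ltW N0.
exists (reallocated c' N T); split.
- apply: admissible_le hF _ _ _ adm_c' _ _ _.
  + exact: reallocated_L1loc.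
  + by move=> t; exact: reallocated_ge0.
  + by move=> t; exact: primitive_reallocated_le.
- apply: (@le_trans _ _ (utility_functional u rho c')).
    (* [c] may be negative on a null set, where [u] is arbitrary, so its integrand need not be
       measurable; that of [c'] is. *)
    apply: le_integral_nonmeasurable => //.
    + by apply/measurable_EFinP; exact: payoff_measurable.
    + by move=> t _; rewrite lee_fin; exact: payoff_ge0.
    + apply: ae_imply cc' => t ct; rewrite /= in_itv/= andbT => /ct <-.
      exact: lexx.
  apply: (@utility_reallocated R u c' rho N T (B k0 T)) => //.
  + exact: ltW.
  + exact: B_gt0.
  + by apply: admissible_growth hF _ _ _ _ C0 FC c'0 adm_c' _; rewrite addr_ge0.
  + by move=> x; apply: threshold_slope => //; exact: kappa_gt0.
- apply: ae_imply cc' => t ct /andP[t0 tT].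
  by rewrite reallocatedE1// ct.
- apply: aeW => t /andP[t0 tT].
  by rewrite reallocatedE1// ge_min lexx orbT.
Qed.
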